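(* Suppose that $d^\xi(v)\le C$ for every scenario $\xi\in[N]$ and customer $v\in V_+$. For every partial route $H=(S_1,\dots,S_\ell)$, define $$\vec{\mathcal{L}}_C(H)=\sum_{\xi\in[N]}p_\xi\sum_{j\in[\ell]}\mathcal{L}^1_\xi\Big(\sum_{i\in[j-1]}d^\xi(S_i),\,S_j\Big),$$ $\overleftarrow{\mathcal{L}}_C(H)=\vec{\mathcal{L}}_C(H')$ where $H'=(S_\ell,\dots,S_1)$, and $\mathcal{L}_C(H)=\min\{\vec{\mathcal{L}}_C(H),\overleftarrow{\mathcal{L}}_C(H)\}$. Then, for every route $R$ that adheres to $H$, $\mathcal{Q}_C(R)\ge\mathcal{L}_C(H)$.
   Context: $G=(V,E)$ is a complete undirected graph with $V=\{0\}\,\dot\cup\,V_+$ ($0$ the depot, $V_+$ the finite set of customers) and edge costs $c\in\mathbb{Q}^E_+$. Capacity $C\in\mathbb{Q}_{++}$; scenario demand vectors $d^1,\dots,d^N\in\mathbb{Q}^{V_+}_+$ with probabilities $p_1,\dots,p_N\in\mathbb{Q}_+$ summing to one, such that the expected demand $\sum_\xi p_\xi d^\xi$ has strictly positive entries. $d^\xi(S)=\sum_{v\in S}d^\xi(v)$. For an integer $a$, $[a]=\{1,\dots,a\}$ if $a>0$ and $[a]=\emptyset$ otherwise; $\mathbb{I}(\cdot)$ is the indicator function. A directed route $\vec R=(v_1,\dots,v_\ell)$, $\ell\ge1$, is a sequence of distinct customers (a directed cycle starting and ending at the depot); a route $R$ is a directed route up to reversal, with orientations $\vec R$ and $\overleftarrow{R}$.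 The classical recourse cost is $$\mathcal{Q}_C(\vec R)=\sum_{\xi\in[N]}p_\xi\sum_{j\in[\ell]}2c_{0v_j}\sum_{t=1}^\infty\mathbb{I}\Big(\sum_{i\in[j-1]}d^\xi(v_i)\le tC<\sum_{i\in[j]}d^\xi(v_i)\Big),\qquad \mathcal{Q}_C(R)=\min\{\mathcal{Q}_C(\vec R),\mathcal{Q}_C(\overleftarrow{R})\}.$$ For $\alpha,\beta\in\mathbb{R}_+$, $\mathrm{fail}(\alpha,\beta)=\sum_{t=1}^\infty\mathbb{I}(\alpha\le tC<\alpha+\beta)$. For $\nu\in\mathbb{Z}_{++}$, $\alpha\in\mathbb{R}_+$ and $S=\{v_1,\dots,v_m\}\subseteq V_+$ indexed so that $c_{0v_1}\le\dots\le c_{0v_m}$, $\mathcal{L}^\nu_\xi(\alpha,S)=\sum_{j\in[\mathrm{fail}(\alpha,d^\xi(S))-\nu+1]}2c_{0v_j}$. A partial route is a tuple $H=(S_1,\dots,S_\ell)$ of pairwise disjoint nonempty subsets of $V_+$ such that there is no $i\in[\ell-1]$ with both $|S_i|>1$ and $|S_{i+1}|>1$. Put $h_i=\sum_{j\in[i]}|S_j|$. A directed route $\vec R=(v_1,\dots,v_t)$ adheres to $H$ if $t=h_\ell$ and $S_i=\{v_{h_{i-1}+1},\dots,v_{h_i}\}$ for every $i\in[\ell]$. An (undirected) route $R$ adheres to $H$ if $\vec R$ or $\overleftarrow{R}$ adheres to $H$. *)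

(* Defs.v *)
(* MathComp, with finitely supported sums from MathComp-Classical *)
From HB Require Import structures.
From mathcomp Require Import all_boot all_order all_algebra.
From mathcomp Require Import boolp classical_sets functions cardinality fsbigop.

Set Implicit Arguments.
Unset Strict Implicit.
Unset Printing Implicit Defensive.

Import Order.TTheory GRing.Theory Num.Theory.
Local Open Scope ring_scope.

(* The vertices are [option customer], the depot being [None].  The edges of the
   complete graph are the unordered pairs of distinct vertices, whence the
   symmetry of [cost]; its diagonal carries no meaning and is unconstrained. *)
Record instance := Instance {
  customer : finType;
  cost : option customer -> option customer -> rat;
  capacity : rat;
  nscen : nat;
  demand : 'I_nscen -> customer -> rat;
  prob : 'I_nscen -> rat;
  cost_sym : forall u v, cost u v = cost v u;
  cost_ge0 : forall u v, u != v -> 0 <= cost u v;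
  capacity_gt0 : 0 < capacity;
  demand_ge0 : forall xi v, 0 <= demand xi v;
  prob_ge0 : forall xi, 0 <= prob xi;
  prob_sum1 : \sum_xi prob xi = 1;
  expected_demand_gt0 : forall v, 0 < \sum_xi prob xi * demand xi v
}.

(* The series over t >= 1 of the indicator of a <= t C < b, as a natural number.
   The sum ranges over the support of the summand, which is finite as soon as
   C > 0: see [overflowsE]. *)
Definition overflows (R : realDomainType) (C a b : R) : nat :=
  \big[addn/0%N]_(t \in [set t : nat | (1 <= t)%N]%classic)
     nat_of_bool (a <= t%:R * C < b).

Lemma overflowsE (R : realDomainType) (C a b : R) (n : nat) :
  0 < C -> b <= n%:R * C ->
  overflows C a b = (\sum_(1 <= t < n) (a <= t%:R * C < b)%R)%N.
Proof.
move=> C0 bn; rewrite /overflows.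
rewrite (fsbigE (index_iota 1 n)) ?iota_uniq //.
- rewrite big_seq_cond [RHS]big_seq_cond; apply: eq_bigl => t.
  rewrite mem_index_iota; case: (boolP (0 < t < n)%N) => //= /andP[t0 _].
  exact: mem_set.
- by move=> t /=; rewrite mem_index_iota => /andP[].
move=> t /= t0; rewrite mem_index_iota t0 /= -leqNgt => nt.
rewrite [t%:R * C < b]ltNge (le_trans bn) ?andbF //.
by rewrite ler_wpM2r ?ler_nat // ltW.
Qed.

Definition failures (R : realDomainType) (C alpha beta : R) : nat :=
  overflows C alpha (alpha + beta).

Section Routes.
Context (I : instance).
Implicit Types (v : seq (customer I)) (S : {set customer I}).
Implicit Types (H : seq {set customer I}).

Definition depot_cost (w : customer I) : rat := cost None (Some w).

Definition set_demand (xi : 'I_(nscen I)) S : rat := \sum_(w in S) demand xi w.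

Definition directed_route v : bool := (v != [::]) && uniq v.

Definition dir_recourse v : rat :=
  \sum_(xi < nscen I) prob xi *
    \sum_(j < size v) 2 * depot_cost (tnth (in_tuple v) j) *
      (overflows (capacity I) (\sum_(w <- take j v) demand xi w)
                              (\sum_(w <- take j.+1 v) demand xi w))%:R.

(* An undirected route is represented by either one of its two orientations;
   what follows does not depend on the choice ([recourse_rev], [adheres_rev]). *)
Definition recourse v : rat := Num.min (dir_recourse v) (dir_recourse (rev v)).

Lemma recourse_rev v : recourse (rev v) = recourse v.
Proof. by rewrite /recourse revK minC. Qed.

(* [(f + 1 - nu)%N] is truncated, so that nothing is summed when f - nu + 1 <= 0.
   The positions j > #|S| would contribute nothing; with alpha >= 0, nu >= 1 and
   all demands at most the capacity, f - nu + 1 <= #|S| and there are none.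
   The value does not depend on how the sort breaks ties. *)
Definition Lfail (xi : 'I_(nscen I)) (nu : nat) (alpha : rat) S : rat :=
  let f := failures (capacity I) alpha (set_demand xi S) in
  let s := sort (fun u w => depot_cost u <= depot_cost w) (enum S) in
  \sum_(w <- take (f + 1 - nu)%N s) 2 * depot_cost w.

(* [sorted] constrains pairs of consecutive blocks only. *)
Definition partial_route H : bool :=
  [&& pairwise (fun S S' => [disjoint S & S']) H,
      finset.set0 \notin H
    & sorted (fun S S' => ~~ ((1 < #|S|)%N && (1 < #|S'|)%N)) H].

Definition hsize H (i : nat) : nat := (\sum_(S <- take i H) #|S|)%N.

(* With blocks numbered from 0, the i-th one must collect the customers at
   positions hsize H i, ..., hsize H i.+1 - 1, also numbered from 0. *)
Definition dir_adheres v H : Prop :=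
  size v = hsize H (size H) /\
  forall i, (i < size H)%N ->
    nth finset.set0 H i = [set w in drop (hsize H i) (take (hsize H i.+1) v)].

Definition adheres v H : Prop := dir_adheres v H \/ dir_adheres (rev v) H.

Lemma adheres_rev v H : adheres (rev v) H <-> adheres v H.
Proof. by rewrite /adheres revK; split; case; [right | left | right | left]. Qed.

Definition dir_lower_bound H : rat :=
  \sum_(xi < nscen I) prob xi *
    \sum_(j < size H)
      Lfail xi 1 (\sum_(S <- take j H) set_demand xi S) (nth finset.set0 H j).

Definition lower_bound H : rat :=
  Num.min (dir_lower_bound H) (dir_lower_bound (rev H)).

End Routes.

(* Main.v *)
Require Import Defs.
From mathcomp Require Import all_boot all_order all_algebra.
Import Order.TTheory GRing.Theory Num.Theory.
Local Open Scope ring_scope.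

(** Customers whose demand is at most the capacity fail at most once each: the
    half-open interval of loads covered by one customer is no longer than C, so
    it holds at most one multiple of C ([overflows_le1]).  Failure counts are
    also additive over consecutive intervals ([overflows_chain]).  Hence, in a
    fixed scenario, the customers of a route that occupy one block S of the
    partial route and start from load alpha incur the cost of exactly
    fail(alpha, d(S)) distinct customers of S ([run_cost_failing]), which is at
    least the cost of the same number of cheapest customers of S
    ([Lfail_le_run_cost]).  A block is visited from a load that depends on the
    previous blocks as sets, not on the order inside them, so these estimates
    add up along the route ([dir_lower_bound_le]).

    Reversing a route that adheres to H gives one that adheres to the reverse of
    H.  Each orientation of the route is thus bounded by one of the two directed
    bounds, and the minima compare.  Adherence is handled as a cutting of the
    route into consecutive pieces with prescribed underlying sets
    ([dir_adheresP]), a form in which reversal is immediate. *)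

Section Overflows.
Set Implicit Arguments.
Unset Strict Implicit.
Context {R : archiRealFieldType} {C : R}.
Hypothesis C_gt0 : 0 < C.

Lemma multiple_above (x : R) : exists n : nat, x <= n%:R * C.
Proof.
exists (Num.bound `|x / C|); rewrite -ler_pdivrMr //.
by apply: ltW; apply: le_lt_trans (ler_norm _) (archi_boundP (normr_ge0 _)).
Qed.

Lemma overflows_chain (a b c : R) : a <= b -> b <= c ->
  overflows C a c = (overflows C a b + overflows C b c)%N.
Proof.
move=> ab bc; have [n cn] := multiple_above c.
rewrite !(@overflowsE _ _ _ _ n) ?(le_trans bc) // -big_split /=.
apply: eq_bigr => t _; set x := t%:R * C.
have [xb|bx] := ltP x b; first by rewrite (lt_le_trans xb bc) !andbT addn0.
by rewrite (le_trans ab bx) andbF.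
Qed.

Lemma overflows_le1 (a b : R) : b <= a + C -> (overflows C a b <= 1)%N.
Proof.
move=> bC; have [n bn] := multiple_above b.
rewrite (@overflowsE _ _ _ _ n) //; elim: n {bn} => [|n IHn].
  by rewrite big_geq.
have [->|n_gt0] := posnP n; first by rewrite big_geq.
rewrite big_nat_recr //=; case: (boolP (_ && _)) => [/andP[_ nb]|_].
  (* A multiple t C below n C is at most n C - C < b - C <= a. *)
  rewrite big_nat big1 // => t /andP[_ tn].
  apply/eqP; rewrite eqb0 negb_and -ltNge; apply/orP; left.
  rewrite -(ltrD2r C) (lt_le_trans _ bC) // (le_lt_trans _ nb) //.
  by rewrite -{2}[C]mul1r -mulrDl natr1 ler_wpM2r ?ler_nat // ltW.
by rewrite addn0.
Qed.

Lemma overflows_refl (a : R) : overflows C a a = 0%N.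
Proof.
have [n an] := multiple_above a.
by rewrite (@overflowsE _ _ _ _ n) // big1 // => t _; rewrite le_lt_asym.
Qed.

End Overflows.

(** The head of a sorted list is at most the head of any of its subsequences, and
    both tails are again in the same situation. *)
Lemma sum_prefix_le_subseq {T : eqType} {R : numDomainType} (f : T -> R)
    (r t : seq T) :
  sorted (fun x y => f x <= f y) r -> subseq t r ->
  \sum_(w <- take (size t) r) f w <= \sum_(w <- t) f w.
Proof.
elim: r t => [|x r IHr] [|y t]; rewrite ?big_nil //= => xr sub.
have f_trans : transitive (fun u w => f u <= f w) by move=> u w z; apply: le_trans.
have sub_t : subseq t r.
  by case: eqP sub => // _ sub; apply: subseq_trans sub; apply: subseq_cons.
have fxy : f x <= f y.
  case: eqP sub => [-> //|_ /mem_subseq sub].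
  by move/(order_path_min f_trans)/allP: (xr); apply; rewrite sub ?mem_head.
by rewrite !big_cons lerD // IHr // (path_sorted xr).
Qed.

Section Scenario.
Set Implicit Arguments.
Unset Strict Implicit.
Context {I : instance} (xi : 'I_(nscen I)).
Implicit Types (a : rat) (s v : seq (customer I)) (vs : seq (seq (customer I))).

Lemma set_demandE s : uniq s ->
  set_demand xi [set w in s] = \sum_(w <- s) demand xi w.
Proof.
by move=> s_uniq; rewrite big_uniq //; apply: eq_bigl => w; rewrite inE.
Qed.

(** Starting from an arbitrary load [a] is what makes the cost of a concatenation
    split into the costs of its pieces. *)
Fixpoint run_cost a s : rat :=
  if s is w :: s' then
    2 * depot_cost w * (overflows (capacity I) a (a + demand xi w))%:R
    + run_cost (a + demand xi w) s'
  else 0.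

Lemma run_cost_cat a s1 s2 :
  run_cost a (s1 ++ s2) =
    run_cost a s1 + run_cost (a + \sum_(w <- s1) demand xi w) s2.
Proof.
elim: s1 a => [|w s IHs] a /=; first by rewrite big_nil addr0 add0r.
by rewrite IHs big_cons !addrA.
Qed.

Lemma run_costE a s :
  run_cost a s =
    \sum_(j < size s) 2 * depot_cost (tnth (in_tuple s) j) *
      (overflows (capacity I) (a + \sum_(w <- take j s) demand xi w)
                              (a + \sum_(w <- take j.+1 s) demand xi w))%:R.
Proof.
elim: s a => [|w s IHs] a; first by rewrite big_ord0.
rewrite /= big_ord_recl /= take0 big_nil addr0 big_seq1 (tnth_nth w) IHs.
congr (_ + _); apply: eq_bigr => j _.
by rewrite !(tnth_nth w) /= !big_cons !addrA.
Qed.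

Hypothesis demand_le : forall w, demand xi w <= capacity I.

(** Each customer of the run fails zero times or once, so the weighted sum of
    failure counts is a plain sum over the customers that fail; by additivity
    their number depends only on the total demand of the run, not on its order. *)
Lemma run_cost_failing a s : exists2 t, subseq t s &
  size t = failures (capacity I) a (\sum_(w <- s) demand xi w)
  /\ run_cost a s = \sum_(w <- t) 2 * depot_cost w.
Proof.
have C_gt0 := @capacity_gt0 I; rewrite /failures.
elim: s a => [|w s IHs] a.
  by exists [::]; rewrite // !big_nil addr0 overflows_refl.
have [t sub_t [size_t cost_t]] := IHs (a + demand xi w).
have chain : overflows (capacity I) a (a + \sum_(u <- w :: s) demand xi u) =
    (overflows (capacity I) a (a + demand xi w) + size t)%N.
  rewrite size_t big_cons addrA -overflows_chain ?lerDl ?demand_ge0 //.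
  by apply: sumr_ge0 => u _; apply: demand_ge0.
rewrite chain /= cost_t.
have: (overflows (capacity I) a (a + demand xi w) <= 1)%N.
  by rewrite overflows_le1 // lerD2l.
case: (overflows _ _ _) => [|[|//]] _.
  exists t; first exact: subseq_trans sub_t (subseq_cons _ _).
  by rewrite mulr0 add0r.
by exists (w :: t); rewrite /= ?eqxx // big_cons mulr1.
Qed.

(** The customers of [s] that fail and those counted by [Lfail] are equally many,
    and [Lfail] takes the cheapest ones. *)
Lemma Lfail_le_run_cost a s : uniq s ->
  Lfail xi 1 a [set w in s] <= run_cost a s.
Proof.
move=> s_uniq; have [t sub_t [size_t ->]] := run_cost_failing a s.
rewrite /Lfail set_demandE // -size_t addnK -!mulr_sumr ler_wpM2l //.
set r := sort _ _.
have r_uniq : uniq r by rewrite sort_uniq enum_uniq.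
have mem_r : r =i s by move=> w; rewrite mem_sort mem_enum inE.
(* The failing customers, listed by increasing depot cost. *)
have perm_t : perm_eq [seq w <- r | w \in t] t.
  apply: uniq_perm; rewrite ?filter_uniq ?(subseq_uniq sub_t) // => w.
  rewrite mem_filter mem_r; case: (boolP (w \in t)) => //= w_t.
  exact: (mem_subseq sub_t).
rewrite -(perm_big _ perm_t) -(perm_size perm_t).
apply: sum_prefix_le_subseq (filter_subseq _ _).
by apply: sort_sorted => u w; apply: le_total.
Qed.

Lemma sum_Lfail_le_run_cost a vs : uniq (flatten vs) ->
  let H := [seq [set w in s] | s <- vs] in
  \sum_(j < size H)
      Lfail xi 1 (a + \sum_(S <- take j H) set_demand xi S) (nth finset.set0 H j)
    <= run_cost a (flatten vs).
Proof.
elim: vs a => [|s vs IHvs] a /=; first by rewrite big_ord0.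
rewrite cat_uniq => /and3P[s_uniq _ vs_uniq].
rewrite big_ord_recl run_cost_cat /= big_nil addr0.
apply: lerD; first exact: Lfail_le_run_cost.
apply: le_trans (IHvs _ vs_uniq); rewrite le_eqVlt; apply/orP; left; apply/eqP.
by apply: eq_bigr => j _; rewrite big_cons addrA set_demandE.
Qed.

End Scenario.

Section Adherence.
Set Implicit Arguments.
Unset Strict Implicit.
Context {I : instance}.
Implicit Types (v : seq (customer I)) (vs : seq (seq (customer I))).
Implicit Types (H : seq {set customer I}).

(** The pieces are the route cut according to the cardinalities of the blocks;
    the positions [hsize H i] are the partial sums of this shape. *)
Lemma dir_adheresP v H : dir_adheres v H ->
  exists2 vs, v = flatten vs & H = [seq [set w in s] | s <- vs].
Proof.
case=> size_v blocks; pose sh := [seq #|A : {set customer I}| | A <- H].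
have hsizeE i : hsize H i = sumn (take i sh).
  by rewrite /hsize -map_take sumnE big_map.
have size_sh : size sh = size H by rewrite size_map.
have size_vs : size (reshape sh v) = size H by rewrite size_reshape.
exists (reshape sh v).
  by rewrite reshapeKr // size_v hsizeE -size_sh take_size.
apply: (@eq_from_nth _ finset.set0); first by rewrite size_map size_vs.
move=> i iH; rewrite (nth_map [::]) ?size_vs // nth_reshape blocks // take_drop.
by rewrite !hsizeE (take_nth 0%N) ?size_sh // sumn_rcons addnC.
Qed.

Lemma dir_lower_bound_le vs :
  (forall (xi : 'I_(nscen I)) (w : customer I), demand xi w <= capacity I) ->
  uniq (flatten vs) ->
  dir_lower_bound [seq [set w in s] | s <- vs] <= dir_recourse (flatten vs).
Proof.
move=> demand_le vs_uniq; apply: ler_sum => xi _.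
apply: ler_wpM2l; first exact: prob_ge0.
have := @sum_Lfail_le_run_cost I xi (demand_le xi) 0 vs vs_uniq.
rewrite run_costE /=; under eq_bigr do rewrite add0r.
by under [X in _ <= X]eq_bigr do rewrite !add0r.
Qed.

Lemma flatten_rev_blocks vs :
  flatten [seq rev s | s <- rev vs] = rev (flatten vs).
Proof. by rewrite rev_flatten map_rev. Qed.

Lemma rev_blocks_sets vs :
  [seq [set w in s] | s <- [seq rev s | s <- rev vs]] =
  rev [seq [set w in s] | s <- vs].
Proof.
rewrite -map_comp map_rev; congr rev; apply: eq_map => s /=.
by apply/setP => w; rewrite !inE mem_rev.
Qed.

Lemma lower_bound_le_of_dir_adheres v H :
  (forall (xi : 'I_(nscen I)) (w : customer I), demand xi w <= capacity I) ->
  uniq v -> dir_adheres v H -> lower_bound H <= recourse v.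
Proof.
move=> demand_le v_uniq /dir_adheresP[vs v_vs ->].
rewrite /recourse /lower_bound; rewrite {}v_vs in v_uniq *.
have := dir_lower_bound_le demand_le v_uniq.
have := @dir_lower_bound_le [seq rev s | s <- rev vs] demand_le.
rewrite flatten_rev_blocks rev_blocks_sets rev_uniq => /(_ v_uniq) le_rev le_dir.
by rewrite le_min !ge_min le_dir le_rev orbT.
Qed.

End Adherence.

Theorem proposition3 (I : instance)
    (demand_le_capacity :
       forall (xi : 'I_(nscen I)) (w : customer I), demand xi w <= capacity I)
    (H : seq {set customer I}) (partH : partial_route H)
    (R : seq (customer I)) (routeR : directed_route R) (adhRH : adheres R H) :
  recourse R >= lower_bound H.
Proof.
have [_ R_uniq] := andP routeR.
case: adhRH => [|adh]; first exact: lower_bound_le_of_dir_adheres.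
rewrite -recourse_rev; apply: lower_bound_le_of_dir_adheres adh => //.
by rewrite rev_uniq.
Qed.
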